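(* Let $\Gamma$ be an environment, $\Sigma$ a finite set of qubit names, $\Phi$ a finite map from channel names to channel types, and $P$, $Q$ processes. If $\Gamma;\Sigma;\Phi\vdash P\mid Q$, then $\mathit{fq}(P)\cap\mathit{fq}(Q)=\emptyset$.
   Context: Syntax (language CQP). Types: $T ::= \mathsf{Int}\mid\mathsf{Unit}\mid\mathsf{Qbit}\mid\widehat{\ }[T_1,\dots,T_n]\mid\mathsf{Op}(n)$, where $\widehat{\ }[T_1,\dots,T_n]$ is the type of channels carrying $n$-tuples and $\mathsf{Op}(n)$ ($n\ge1$) the type of unitary operators on $n$ qubits. There are disjoint countably infinite sets of variables $x$, qubit names $q$, channel names $c$, and a set of operator constants $U$, each with an arity $n\geq 1$. Values: $v ::= x\mid q\mid c\mid$ integer literal $\mid\mathsf{unit}\mid U$. Expressions: $e ::= v\mid \mathsf{measure}\ e_1,\dots,e_n\mid (e_1,\dots,e_n \mathbin{*\!=} e)\mid e+e'$. Processes: $P ::= \mathbf 0\mid (P\mid P)\mid e?[x_1{:}T_1,\dots,x_n{:}T_n].P\mid e![e_1,\dots,e_n].P\mid\{e\}.P\mid(\mathsf{new}\ x{:}T)P\mid(\mathsf{qbit}\ x)P$; input, $\mathsf{new}$ and $\mathsf{qbit}$ bind the indicated variables in $P$. Processes are considered up to renaming of bound variables, bound variables being chosen distinct from the other variables in play (in particular from those in the typing environment). $\mathit{fq}(P)$ is the set of qubit names occurring in $P$ (qubit names are never bound). Typing. Environments $\Gamma$ are finite maps from variables to types; $\Sigma$ is a finite set of qubit names; $\Phi$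 is a finite map from channel names to channel types. A comma ($\Gamma,x{:}T$; $\Sigma,q$; $\Phi,c{:}T$) denotes extension by elements not already present. $\Gamma+x{:}T$ is $\Gamma,x{:}T$ if $x\notin\mathrm{dom}(\Gamma)$; it is $\Gamma$ if $T\ne\mathsf{Qbit}$ and $x{:}T\in\Gamma$; otherwise undefined; this extends inductively to a partial operation $\Gamma_1+\Gamma_2$. $\Sigma_1+\Sigma_2$ is disjoint union, defined only if $\Sigma_1\cap\Sigma_2=\emptyset$. Expression rules for $\Gamma;\Sigma;\Phi\vdash e:T$: integer literals have type $\mathsf{Int}$; $\mathsf{unit}$ has type $\mathsf{Unit}$; an operator constant of arity $n$ has type $\mathsf{Op}(n)$; $x$ has type $T$ if $x{:}T\in\Gamma$; $q$ has type $\mathsf{Qbit}$ if $q\in\Sigma$; $c$ has type $T$ if $c{:}T\in\Phi$; $e+e'$ has type $\mathsf{Int}$ if $e,e'$ both have type $\mathsf{Int}$; $\mathsf{measure}\ e_1,\dots,e_n$ has type $\mathsf{Int}$ if every $e_i$ has type $\mathsf{Qbit}$; $(e_1,\dots,e_n\mathbin{*\!=}e)$ has type $\mathsf{Unit}$ if every $e_i$ has type $\mathsf{Qbit}$, every $e_i$ is a variable or a qubit name, the $e_i$ are all distinct, and $e$ has type $\mathsf{Op}(n)$ (all in the same $\Gamma;\Sigma;\Phi$). Process rules for $\Gamma;\Sigma;\Phi\vdash P$: (Nil) $\Gamma;\Sigma;\Phi\vdash\mathbf 0$ always. (Par) if $\Gamma_1;\Sigma_1;\Phi\vdash P$ and $\Gamma_2;\Sigma_2;\Phi\vdash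 Q$, and $\Gamma_1+\Gamma_2$, $\Sigma_1+\Sigma_2$ are defined, then $\Gamma_1+\Gamma_2;\Sigma_1+\Sigma_2;\Phi\vdash P\mid Q$. (In) if $\Gamma;\Sigma;\Phi\vdash e:\widehat{\ }[T_1,\dots,T_n]$ and $\Gamma,y_1{:}T_1,\dots,y_n{:}T_n;\Sigma;\Phi\vdash P$ then $\Gamma;\Sigma;\Phi\vdash e?[y_1{:}T_1,\dots,y_n{:}T_n].P$. (Out) if $\Gamma;\Sigma;\Phi\vdash e:\widehat{\ }[T_1,\dots,T_m,\mathsf{Qbit},\dots,\mathsf{Qbit}]$ (with $n\ge 0$ trailing $\mathsf{Qbit}$s), all $T_i\neq\mathsf{Qbit}$, $\Gamma;\Sigma;\Phi\vdash e_i:T_i$ for $1\le i\le m$, $f_1,\dots,f_n$ consist of distinct variables $\tilde f_x$ and distinct qubit names $\tilde f_q$, and $\Gamma;\Sigma;\Phi\vdash P$, then $\Gamma,\tilde f_x{:}\widetilde{\mathsf{Qbit}};\Sigma,\tilde f_q;\Phi\vdash e![e_1,\dots,e_m,f_1,\dots,f_n].P$. (Act) if $\Gamma;\Sigma;\Phi\vdash e:T$ and $\Gamma;\Sigma;\Phi\vdash P$ then $\Gamma;\Sigma;\Phi\vdash\{e\}.P$. (New) if $\Gamma,x{:}\widehat{\ }[T_1,\dots,T_n];\Sigma;\Phi\vdash P$ then $\Gamma;\Sigma;\Phi\vdash(\mathsf{new}\ x{:}\widehat{\ }[T_1,\dots,T_n])P$. (Qbit) if $\Gamma,x{:}\mathsf{Qbit};\Sigma;\Phi\vdash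 P$ then $\Gamma;\Sigma;\Phi\vdash(\mathsf{qbit}\ x)P$. *)

(* Defs.v *)
From Stdlib Require List.
From mathcomp Require Import all_boot all_algebra finmap.

Set Implicit Arguments.
Unset Strict Implicit.
Unset Printing Implicit Defensive.

Local Open Scope fset_scope.

(* The three sorts of names are kept disjoint by the constructors of [value]. *)
Definition var := nat.
Definition qname := nat.
Definition cname := nat.

Definition posnat := {n : nat | 0 < n}.

Inductive ty : Type :=
| TInt
| TUnit
| TQbit
| TChan of seq ty
| TOp of posnat.

(* [U] is the set of operator constants; its arity function [U -> posnat]
   is a parameter of the typing judgements. *)
Inductive value (U : Type) : Type :=
| VVar of var
| VQbit of qname
| VChan of cname
| VInt of int
| VUnit
| VOp of U.

Arguments VVar {U}.
Arguments VQbit {U}.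
Arguments VChan {U}.
Arguments VInt {U}.
Arguments VUnit {U}.

Inductive expr (U : Type) : Type :=
| EVal of value U
| EMeasure of seq (expr U)
| ETrans of seq (expr U) & expr U
| EAdd of expr U & expr U.

Inductive proc (U : Type) : Type :=
| PNil
| PPar of proc U & proc U
| PIn of expr U & seq (var * ty) & proc U
| POut of expr U & seq (expr U) & proc U
| PAct of expr U & proc U
| PNew of var & ty & proc U
| PQbit of var & proc U.

Arguments PNil {U}.

Definition fq_value (U : Type) (v : value U) : {fset qname} :=
  if v is VQbit q then [fset q] else fset0.

Fixpoint fq_expr (U : Type) (e : expr U) : {fset qname} :=
  match e with
  | EVal v => fq_value v
  | EMeasure es => foldr (fun e' A => fq_expr e' `|` A) fset0 es
  | ETrans es e1 => foldr (fun e' A => fq_expr e' `|` A) (fq_expr e1) es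
  | EAdd e1 e2 => fq_expr e1 `|` fq_expr e2
  end.

Fixpoint fq (U : Type) (P : proc U) : {fset qname} :=
  match P with
  | PNil => fset0
  | PPar P1 P2 => fq P1 `|` fq P2
  | PIn e _ P1 => fq_expr e `|` fq P1
  | POut e es P1 =>
      fq_expr e `|` foldr (fun e' A => fq_expr e' `|` A) (fq P1) es
  | PAct e P1 => fq_expr e `|` fq P1
  | PNew _ _ P1 => fq P1
  | PQbit _ P1 => fq P1
  end.

Definition fv_value (U : Type) (v : value U) : {fset var} :=
  if v is VVar x then [fset x] else fset0.

Fixpoint fv_expr (U : Type) (e : expr U) : {fset var} :=
  match e with
  | EVal v => fv_value v
  | EMeasure es => foldr (fun e' A => fv_expr e' `|` A) fset0 es
  | ETrans es e1 => foldr (fun e' A => fv_expr e' `|` A) (fv_expr e1) es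
  | EAdd e1 e2 => fv_expr e1 `|` fv_expr e2
  end.

Fixpoint fv (U : Type) (P : proc U) : {fset var} :=
  match P with
  | PNil => fset0
  | PPar P1 P2 => fv P1 `|` fv P2
  | PIn e ys P1 => fv_expr e `|` (fv P1 `\` [fset y in unzip1 ys])
  | POut e es P1 =>
      fv_expr e `|` foldr (fun e' A => fv_expr e' `|` A) (fv P1) es
  | PAct e P1 => fv_expr e `|` fv P1
  | PNew x _ P1 => fv P1 `\ x
  | PQbit x P1 => fv P1 `\ x
  end.

Definition swap_var (a b x : var) : var :=
  if x == a then b else if x == b then a else x.

Definition swap_value (U : Type) (a b : var) (v : value U) : value U :=
  if v is VVar x then VVar (swap_var a b x) else v.

Fixpoint swap_expr (U : Type) (a b : var) (e : expr U) : expr U :=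
  match e with
  | EVal v => EVal (swap_value a b v)
  | EMeasure es => EMeasure (map (swap_expr a b) es)
  | ETrans es e1 => ETrans (map (swap_expr a b) es) (swap_expr a b e1)
  | EAdd e1 e2 => EAdd (swap_expr a b e1) (swap_expr a b e2)
  end.

Definition swap_params (a b : var) (ys : seq (var * ty)) : seq (var * ty) :=
  [seq (swap_var a b y.1, y.2) | y <- ys].

(* Exchanges [a] and [b] everywhere, binding occurrences included; this
   commutes with binding, so renaming a bound variable to a fresh one needs
   no capture-avoiding substitution. *)
Fixpoint swap (U : Type) (a b : var) (P : proc U) : proc U :=
  match P with
  | PNil => PNil
  | PPar P1 P2 => PPar (swap a b P1) (swap a b P2)
  | PIn e ys P1 => PIn (swap_expr a b e) (swap_params a b ys) (swap a b P1)
  | POut e es P1 =>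
      POut (swap_expr a b e) (map (swap_expr a b) es) (swap a b P1)
  | PAct e P1 => PAct (swap_expr a b e) (swap a b P1)
  | PNew x T P1 => PNew (swap_var a b x) T (swap a b P1)
  | PQbit x P1 => PQbit (swap_var a b x) (swap a b P1)
  end.

Inductive alpha (U : Type) : proc U -> proc U -> Prop :=
| alpha_in_rename e ys P x y :
    x \in unzip1 ys -> y \notin unzip1 ys -> y \notin fv P ->
    alpha (PIn e ys P) (PIn e (swap_params x y ys) (swap x y P))
| alpha_new_rename x T P y :
    y \notin fv P -> alpha (PNew x T P) (PNew y T (swap x y P))
| alpha_qbit_rename x P y :
    y \notin fv P -> alpha (PQbit x P) (PQbit y (swap x y P))
| alpha_refl P : alpha P P
| alpha_sym P Q : alpha P Q -> alpha Q P
| alpha_trans P Q R : alpha P Q -> alpha Q R -> alpha P R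
| alpha_par P P' Q Q' :
    alpha P P' -> alpha Q Q' -> alpha (PPar P Q) (PPar P' Q')
| alpha_in e ys P P' : alpha P P' -> alpha (PIn e ys P) (PIn e ys P')
| alpha_out e es P P' : alpha P P' -> alpha (POut e es P) (POut e es P')
| alpha_act e P P' : alpha P P' -> alpha (PAct e P) (PAct e P')
| alpha_new x T P P' : alpha P P' -> alpha (PNew x T P) (PNew x T P')
| alpha_qbit x P P' : alpha P P' -> alpha (PQbit x P) (PQbit x P').

Definition env := {fmap var -> ty}.

(* A channel name is mapped to the list [Ts] of its type [TChan Ts], so that
   only channel types occur in the range. *)
Definition cenv := {fmap cname -> seq ty}.

(* The extension G, y_1:T_1, ..., y_n:T_n; it is only meaningful under
   [fresh_for G (unzip1 ys)]. *)
Definition env_ext (G : env) (ys : seq (var * ty)) : env :=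
  foldl (fun H y => H.[y.1 <- y.2]%fmap) G ys.

Definition fresh_for (G : env) (xs : seq var) : bool :=
  uniq xs && all (fun x => x \notin domf G) xs.

(* The partial operations G + x:T and G1 + G2 are given by their graphs. *)
Inductive env_add1 (G : env) (x : var) (T : ty) : env -> Prop :=
| env_add1_new : x \notin domf G -> env_add1 G x T G.[x <- T]%fmap
| env_add1_shared : T <> TQbit -> G.[? x]%fmap = Some T -> env_add1 G x T G.

Inductive env_add (G1 : env) : env -> env -> Prop :=
| env_add_nil : env_add G1 fmap0 G1
| env_add_cons G2 x T G G' :
    x \notin domf G2 -> env_add G1 G2 G -> env_add1 G x T G' ->
    env_add G1 G2.[x <- T]%fmap G'.

(* The expressions that are a variable ([inl]) or a qubit name ([inr]). *)
Definition name_expr (U : Type) (f : var + qname) : expr U :=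
  EVal (match f with inl x => VVar x | inr q => VQbit q end).

Definition vars_of (fs : seq (var + qname)) : seq var :=
  pmap (fun f => if f is inl x then Some x else None) fs.

Definition qnames_of (fs : seq (var + qname)) : seq qname :=
  pmap (fun f => if f is inr q then Some q else None) fs.

Inductive expr_typed (U : Type) (arity : U -> posnat)
    (G : env) (S : {fset qname}) (F : cenv) : expr U -> ty -> Prop :=
| T_IntLit z : expr_typed arity G S F (EVal (VInt z)) TInt
| T_Unit : expr_typed arity G S F (EVal VUnit) TUnit
| T_Op u : expr_typed arity G S F (EVal (VOp u)) (TOp (arity u))
| T_Var x T :
    G.[? x]%fmap = Some T -> expr_typed arity G S F (EVal (VVar x)) T
| T_IdQ q : q \in S -> expr_typed arity G S F (EVal (VQbit q)) TQbit
| T_IdC c Ts :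
    F.[? c]%fmap = Some Ts ->
    expr_typed arity G S F (EVal (VChan c)) (TChan Ts)
| T_Add e1 e2 :
    expr_typed arity G S F e1 TInt -> expr_typed arity G S F e2 TInt ->
    expr_typed arity G S F (EAdd e1 e2) TInt
| T_Measure es :
    List.Forall (fun e => expr_typed arity G S F e TQbit) es ->
    expr_typed arity G S F (EMeasure es) TInt
| T_Trans (fs : seq (var + qname)) e (n : posnat) :
    uniq fs -> size fs = val n ->
    List.Forall (fun e' => expr_typed arity G S F e' TQbit)
      (map (@name_expr U) fs) ->
    expr_typed arity G S F e (TOp n) ->
    expr_typed arity G S F (ETrans (map (@name_expr U) fs) e) TUnit.

(* Processes are identified up to [alpha]: by [T_Alpha], the judgement holds of
   P as soon as it holds of some renaming of the bound variables of P. *)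
Inductive typed (U : Type) (arity : U -> posnat) :
    env -> {fset qname} -> cenv -> proc U -> Prop :=
| T_Alpha G S F P P' :
    alpha P P' -> typed arity G S F P' -> typed arity G S F P
| T_Nil G S F : typed arity G S F PNil
| T_Par G1 G2 G S1 S2 F P Q :
    typed arity G1 S1 F P -> typed arity G2 S2 F Q ->
    env_add G1 G2 G -> S1 `&` S2 = fset0 ->
    typed arity G (S1 `|` S2) F (PPar P Q)
| T_In G S F e ys P :
    expr_typed arity G S F e (TChan (unzip2 ys)) ->
    fresh_for G (unzip1 ys) ->
    typed arity (env_ext G ys) S F P ->
    typed arity G S F (PIn e ys P)
| T_Out G S F e es Ts (fs : seq (var + qname)) P :
    expr_typed arity G S F e (TChan (Ts ++ nseq (size fs) TQbit)) ->
    List.Forall (fun T => T <> TQbit) Ts ->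
    List.Forall2 (expr_typed arity G S F) es Ts ->
    uniq fs -> fresh_for G (vars_of fs) ->
    all (fun q => q \notin S) (qnames_of fs) ->
    typed arity G S F P ->
    typed arity (env_ext G [seq (x, TQbit) | x <- vars_of fs])
      (S `|` [fset q in qnames_of fs]) F
      (POut e (es ++ map (@name_expr U) fs) P)
| T_Act G S F e T P :
    expr_typed arity G S F e T -> typed arity G S F P ->
    typed arity G S F (PAct e P)
| T_New G S F x Ts P :
    x \notin domf G ->
    typed arity G.[x <- TChan Ts]%fmap S F P ->
    typed arity G S F (PNew x (TChan Ts) P)
| T_Qbit G S F x P :
    x \notin domf G ->
    typed arity G.[x <- TQbit]%fmap S F P ->
    typed arity G S F (PQbit x P).

(* Main.v *)
(* Typing confines the qubit names of a process to S, and (Par) splits S into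
   disjoint parts.  Since the judgement is closed under alpha-conversion, a
   derivation for [PPar P Q] need not end with (Par); but renaming bound
   variables changes neither the qubit names nor the top-level parallel
   structure, so disjointness is proved as an alpha-invariant property of
   arbitrary processes. *)
Require Import Defs.
From mathcomp Require Import all_boot all_algebra finmap.

Local Open Scope fset_scope.

Lemma fq_swap_expr (U : Type) (a b : var) (e : expr U) :
  fq_expr (swap_expr a b e) = fq_expr e.
Proof.
(* The explicit [fix] gives a hypothesis that also applies to the expressions nested in the lists of
   [EMeasure] and [ETrans]. *)
move: e; fix IH 1; case=> [[]|es|es e|e1 e2] //=; last by rewrite !IH.
- by elim: es => //= e es ->; rewrite IH.
- by elim: es => [|e' es IHes] /=; rewrite ?IHes IH.
Qed.

Lemma fq_swap (U : Type) (a b : var) (P : proc U) : fq (swap a b P) = fq P.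
Proof.
elim: P => //= [P -> Q ->|e ys P ->|e es P IH|e P ->] //;
  rewrite fq_swap_expr //; congr (_ `|` _).
by elim: es => //= e' es ->; rewrite fq_swap_expr.
Qed.

Lemma alpha_fq (U : Type) (P Q : proc U) : alpha P Q -> fq P = fq Q.
Proof.
elim=> {P Q} //= [e ys P x y|x T P y|x P y|P Q R|P P' Q Q'|e ys P P'|
  e es P P'|e P P'] *; rewrite ?fq_swap //; congruence.
Qed.

(** Total on processes, so that inductions on [alpha] and [typed] need not fix the shape of the
    process. *)
Definition par_disjoint {U : Type} (P : proc U) : bool :=
  if P is PPar P1 P2 then fq P1 `&` fq P2 == fset0 else true.

Lemma alpha_par_disjoint (U : Type) (P Q : proc U) :
  alpha P Q -> par_disjoint P = par_disjoint Q.
Proof.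
elim=> {P Q} //= [P Q R _ -> _ ->|P P' Q Q' aP _ aQ _] //.
by rewrite (alpha_fq _ _ _ aP) (alpha_fq _ _ _ aQ).
Qed.

Lemma foldr_fsetU_sub (T : Type) (K : choiceType) (f : T -> {fset K})
    (A B : {fset K}) (s : seq T) :
  A `<=` B -> List.Forall (fun x => f x `<=` B) s ->
  foldr (fun x C => f x `|` C) A s `<=` B.
Proof. by move=> sAB; elim=> //= x s' fx _ IH; rewrite fsubUset fx. Qed.

(** Only variables and qubit names can have type [TQbit], so case analysis suffices. This handles
    the [List.Forall] premises of [T_Measure] and [T_Trans] without a nested induction. *)
Lemma fq_expr_qbit (U : Type) (arity : U -> posnat) (G : env)
    (S : {fset qname}) (F : cenv) (e : expr U) :
  expr_typed arity G S F e TQbit -> fq_expr e `<=` S.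
Proof.
move: {-2}TQbit (erefl TQbit) => T eT eP.
by case: eP eT => //= q qS _; rewrite fsub1set.
Qed.

Lemma fq_expr_typed (U : Type) (arity : U -> posnat) (G : env)
    (S : {fset qname}) (F : cenv) (e : expr U) (T : ty) :
  expr_typed arity G S F e T -> fq_expr e `<=` S.
Proof.
elim=> {e T} //= [q qS|e1 e2 _ s1 _ s2|es esP|fs e n _ _ fsP _ se].
- by rewrite fsub1set.
- by rewrite fsubUset s1.
- apply: foldr_fsetU_sub => //.
  by apply: List.Forall_impl esP => e; apply: fq_expr_qbit.
- apply: foldr_fsetU_sub => //.
  by apply: List.Forall_impl fsP => e'; apply: fq_expr_qbit.
Qed.

Lemma fq_name_exprs (U : Type) (fs : seq (var + qname)) :
  List.Forall (fun e : expr U => fq_expr e `<=` [fset q in qnames_of fs])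
    (map (@name_expr U) fs).
Proof.
apply/List.Forall_map/List.Forall_forall => f.
elim: fs => //= g fs IH [->|/IH sf].
- by case: f {IH} => //= q; rewrite fsub1set !inE eqxx.
- apply: (fsubset_trans sf); apply/fsubsetP => q; rewrite !inE.
  by case: g => //= q' qfs; rewrite inE qfs orbT.
Qed.

Lemma typed_fq (U : Type) (arity : U -> posnat) (G : env) (S : {fset qname})
    (F : cenv) (P : proc U) : typed arity G S F P -> fq P `<=` S.
Proof.
elim=> {G S F P} //=.
- by move=> G S F P P' /alpha_fq ->.
- by move=> G1 G2 G S1 S2 F P Q _ sP _ sQ _ _; apply: fsetUSS.
- by move=> G S F e ys P /fq_expr_typed se _ _ sP; rewrite fsubUset se.
- move=> G S F e es Ts fs P /fq_expr_typed se _ esP _ _ _ _ sP.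
  rewrite fsubUset (fsubset_trans se (fsubsetUl _ _)) /=.
  apply: foldr_fsetU_sub; first exact: fsubset_trans sP (fsubsetUl _ _).
  (* The arguments [es] are typed under [S], whereas the qubit names among [fs] lie in the part that
     [T_Out] adds to [S]. *)
  apply/List.Forall_app; split.
    elim: esP => //= e' T es' Ts' /fq_expr_typed se' _; constructor => //.
    exact: fsubset_trans se' (fsubsetUl _ _).
  apply: List.Forall_impl (fq_name_exprs U fs) => e' se'.
  exact: fsubset_trans se' (fsubsetUr _ _).
- by move=> G S F e T P /fq_expr_typed se _ sP; rewrite fsubUset se.
Qed.

Lemma typed_par_disjoint (U : Type) (arity : U -> posnat) (G : env)
    (S : {fset qname}) (F : cenv) (P : proc U) :
  typed arity G S F P -> par_disjoint P.
Proof.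
elim=> {G S F P} //= [G S F P P' /alpha_par_disjoint -> //|].
(* For [T_Par], the qubit names of the two components are confined to [S1] and [S2], which are
   disjoint. *)
move=> G1 G2 G S1 S2 F P Q /typed_fq sP _ /typed_fq sQ _ _ S12.
by rewrite -fsubset0 -S12 fsetISS.
Qed.

Theorem theorem2 (U : Type) (arity : U -> posnat)
    (G : env) (S : {fset qname}) (F : cenv) (P Q : proc U) :
  typed arity G S F (PPar P Q) -> fq P `&` fq Q = fset0.
Proof. by move/typed_par_disjoint=> /eqP. Qed.
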